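(* Let $m$ be a positive integer and let $$c_m := \frac{2}{m+1} \sum_{1 \leq j \leq m;\ j \text{ odd}} \cot \Bigl(\frac{\pi j}{2m+2}\Bigr).$$ The inequality $$\sum_{1\leq k\leq m;\ k\text{ odd}}\frac{2}{(m+1)^2} \cot\Bigl( \frac{\pi k}{2m+2}\Bigr)\bigl[(m+1-k) \sin (kx)+ k \sin ((m+1-k)x)\bigr]\leq 1,$$ which holds for all $x\in\mathbb{R}$, is optimal among inequalities of the form $\sum_{k=1}^m a_k \sin (kx)\leq 1$ (for all $x\in\mathbb{R}$, with real coefficients $a_k$), in the sense that it has the maximal value of $\sum_{k=1}^m a_k$ among all valid inequalities of this form; this maximal value is $c_m$. That is: the coefficients of the displayed inequality (written as $\sum_{k=1}^m a_k\sin(kx)\le 1$) sum to $c_m$, and whenever real numbers $a_1,\dots,a_m$ satisfy $\sum_{k=1}^m a_k \sin(kx)\leq 1$ for all $x\in\mathbb{R}$, one has $\sum_{k=1}^m a_k\leq c_m$. *)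

(* Defs.v *)
From mathcomp Require Import all_boot all_order all_algebra.
From mathcomp Require Import reals trigo.

Set Implicit Arguments.
Unset Strict Implicit.
Unset Printing Implicit Defensive.

Import Order.TTheory GRing.Theory Num.Theory.
Local Open Scope ring_scope.

(* Only used at angles pi * j / (2 m + 2) with 1 <= j <= m, which lie in
   ]0, pi / 2[, so the division by sin is never a division by 0. *)
Definition cot (R : realType) (x : R) : R := cos x / sin x.

Definition sine_poly (R : realType) (m : nat) (a : nat -> R) (x : R) : R :=
  \sum_(1 <= k < m.+1) a k * sin (k%:R * x).

Definition cot_const (R : realType) (m : nat) : R :=
  2 / (m%:R + 1) *
  \sum_(1 <= j < m.+1 | odd j) cot (pi * j%:R / (2 * m%:R + 2)).

Definition extremal_sum (R : realType) (m : nat) (x : R) : R :=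
  \sum_(1 <= k < m.+1 | odd k)
    2 / (m%:R + 1) ^+ 2 * cot (pi * k%:R / (2 * m%:R + 2)) *
    ((m%:R + 1 - k%:R) * sin (k%:R * x) +
     k%:R * sin ((m%:R + 1 - k%:R) * x)).

(* Main.v *)
Require Import Defs.
From mathcomp Require Import all_boot all_order all_algebra.
From mathcomp Require Import reals trigo ring lra.

(** Put N = m + 1 and x_j = pi j / N. Both parts rest on the odd-indexed nodes
    x_j with 0 < j < N.

    Upper bound: the nonnegative weights w_j = (2/N) cot(x_j / 2) integrate
    every sin (k x), 0 < k < N, to 1, because cot(x/2) sin(kx) grows by
    cos((k+1)x) + cos(kx) from k to k + 1. Hence sum a_k = sum_j w_j p(x_j), which
    is at most sum_j w_j = c_m when p <= 1.

    Extremal polynomial: up to a factor it is the Fejer interpolant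
    sum_j [F(x - x_j) - F(x + x_j)] of the sign of the sine, with F the Fejer
    kernel. All translates of F to the N odd nodes modulo 2 pi add up to a
    constant, so 1 minus the interpolant is a combination of translates of F
    with nonnegative coefficients. *)

Set Implicit Arguments.
Unset Strict Implicit.
Unset Printing Implicit Defensive.

Import Order.TTheory GRing.Theory Num.Theory.
Local Open Scope ring_scope.

(** * Telescoping trigonometric sums and the Fejer kernel *)

Section Trigonometry.
Variable R : realType.
Implicit Types (a t : R) (n k : nat).

Lemma cos_natpi k : cos (k%:R * pi) = (-1) ^+ k :> R.
Proof.
elim: k => [|k IH]; first by rewrite mul0r cos0.
by rewrite -natr1 mulrDl mul1r cosDpi IH exprS mulN1r.
Qed.

Lemma sin_natpi k : sin (k%:R * pi) = 0 :> R.
Proof.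
elim: k => [|k IH]; first by rewrite mul0r sin0.
by rewrite -natr1 mulrDl mul1r sinDpi IH oppr0.
Qed.

(** Since 2 sin a cos(ja) = sin((j+1)a) - sin((j-1)a), the sum over odd j telescopes; [n - odd n] is
    the even number at which it stops. *)
Lemma sum_odd_cos n a :
  2 * sin a * \sum_(1 <= j < n | odd j) cos (j%:R * a) =
  sin ((n - odd n)%:R * a).
Proof.
elim: n => [|[_|n IH]]; [by rewrite big_geq // mulr0 mul0r sin0.. |].
rewrite big_mkcond big_nat_recr //= -big_mkcond mulrDr IH /=.
case: (odd n) => /=; rewrite ?mulr0 ?addr0 ?subn0 ?subSS ?subn0 //.
have -> : n.+2%:R * a = n.+1%:R * a + a by rewrite -[n.+2%:R]natr1; ring.
have -> : n%:R * a = n.+1%:R * a - a by rewrite -[n.+1%:R]natr1; ring.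
by rewrite sinB sinD; ring.
Qed.

Lemma sum_odd_sin n a :
  2 * sin a * \sum_(1 <= j < n | odd j) sin (j%:R * a) =
  1 - cos ((n - odd n)%:R * a).
Proof.
elim: n => [|[_|n IH]]; [by rewrite big_geq // mulr0 mul0r cos0 subrr.. |].
rewrite big_mkcond big_nat_recr //= -big_mkcond mulrDr IH /=.
case: (odd n) => /=; rewrite ?mulr0 ?addr0 ?subn0 ?subSS ?subn0 //.
have -> : n.+2%:R * a = n.+1%:R * a + a by rewrite -[n.+2%:R]natr1; ring.
have -> : n%:R * a = n.+1%:R * a - a by rewrite -[n.+1%:R]natr1; ring.
by rewrite cosB cosD; ring.
Qed.

(** This is |sum_{k<n} e^{ikt}|^2, the Fejer kernel scaled to have value n^2 at 0. As a sum of
    squares it is visibly nonnegative. *)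
Definition fejer n t : R :=
  (\sum_(0 <= k < n) cos (k%:R * t)) ^+ 2 +
  (\sum_(0 <= k < n) sin (k%:R * t)) ^+ 2.

Lemma fejer_ge0 n t : 0 <= fejer n t.
Proof. by rewrite addr_ge0 ?sqr_ge0. Qed.

Lemma sum_nat_rev n (f : nat -> R) :
  \sum_(1 <= k < n) f (n - k)%N = \sum_(1 <= k < n) f k.
Proof.
by rewrite [RHS]big_nat_rev; apply: eq_bigr => k _; rewrite add1n subSS.
Qed.

Lemma fejerE n t :
  fejer n t = n%:R + 2 * \sum_(1 <= k < n) (n%:R - k%:R) * cos (k%:R * t).
Proof.
elim: n => [|n IH]; first by rewrite /fejer !big_geq // expr0n mulr0 !addr0.
(* Adjoining e^{int} adds its squared modulus 1 and twice the real part of its products with the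
   conjugates of the earlier terms. *)
have -> : fejer n.+1 t =
    fejer n t + 1 + 2 * \sum_(0 <= k < n) cos ((n - k)%:R * t).
  rewrite [in RHS]big_nat.
  under [in RHS]eq_bigr => k /andP[_ lkn].
    rewrite natrB ?(ltnW lkn) // mulrBl cosB.
    over.
  rewrite -big_nat big_split /= -!big_distrr /=.
  rewrite /fejer !big_nat_recr //=.
  have := cos2Dsin2 (n%:R * t); nra.
rewrite IH; case: n {IH} => [|n].
  by rewrite !big_geq // mulr0 !addr0 add0r.
have -> : \sum_(0 <= k < n.+1) cos ((n.+1 - k)%:R * t) =
          \sum_(1 <= k < n.+2) cos (k%:R * t).
  by rewrite -[RHS](sum_nat_rev n.+2 (fun k => cos (k%:R * t))) big_add1.
have -> : \sum_(1 <= k < n.+2) (n.+2%:R - k%:R) * cos (k%:R * t) =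
    \sum_(1 <= k < n.+2) (n.+1%:R - k%:R) * cos (k%:R * t)
    + \sum_(1 <= k < n.+2) cos (k%:R * t).
  by rewrite -big_split; apply: eq_bigr => k _ /=; rewrite -[n.+2%:R]natr1; ring.
rewrite [X in _ = _ + 2 * (X + _)]big_nat_recr //= subrr mul0r addr0.
by rewrite -[n.+2%:R]natr1; ring.
Qed.

End Trigonometry.

(** * The nodes and their half angles *)

Section Nodes.
Variables (R : realType) (N : nat).
Implicit Types (j k : nat) (x : R).

Definition node k : R := pi * k%:R / N%:R.

Lemma node_bounds k : (0 < k < N)%N -> 0 < node k < pi.
Proof.
move=> /andP[k0 kN]; have N0 : (0 < N)%N by apply: leq_trans kN.
rewrite /node divr_gt0 ?mulr_gt0 ?pi_gt0 ?ltr0n //=.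
by rewrite ltr_pdivrMr ?ltr0n // ltr_pM2l ?pi_gt0 // ltr_nat.
Qed.

Lemma sin_node_gt0 k : (0 < k < N)%N -> 0 < sin (node k).
Proof. by move/node_bounds=> ?; apply: sin_gt0_pi. Qed.

Lemma sin_half_node_gt0 k : (0 < k < N)%N -> 0 < sin (node k / 2).
Proof. by move/node_bounds=> ?; apply: sin_gt0_pi; lra. Qed.

Lemma cos_half_node_gt0 k : (0 < k < N)%N -> 0 < cos (node k / 2).
Proof. by move/node_bounds=> ?; apply: cos_gt0_pihalf; have := pi_gt0 R; lra. Qed.

Lemma cot_half_node_ge0 k : (0 < k < N)%N -> 0 <= cot (node k / 2).
Proof.
by move=> kN; rewrite divr_ge0 ?ltW ?sin_half_node_gt0 ?cos_half_node_gt0.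
Qed.

Lemma half_nodeB k : (0 < k < N)%N -> node (N - k) / 2 = pi / 2 - node k / 2.
Proof.
move=> /andP[k0 kN]; have N0 : N%:R != 0 :> R by rewrite pnatr_eq0; case: N kN.
by rewrite /node natrB 1?ltnW //; field.
Qed.

Lemma cot_half_nodeB k : (0 < k < N)%N ->
  cot (node (N - k) / 2) = sin (node k / 2) / cos (node k / 2).
Proof.
move=> kN; rewrite half_nodeB // /cot cosB sinB cos_pihalf sin_pihalf.
by rewrite !mul0r !mul1r add0r subr0.
Qed.

(** * Cosine and sine sums over the odd nodes *)

Lemma mul_nodeC j k : j%:R * node k = k%:R * node j.
Proof. by rewrite /node; ring. Qed.

(** Evaluates the end term of [sum_odd_sin] at a = [node k], where N a = k pi. *)
Lemma cos_mulsub_node k : (0 < k < N)%N ->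
  cos ((N - odd N)%:R * node k) = (-1) ^+ k * (if odd N then cos (node k) else 1).
Proof.
move=> /andP[k0 kN]; have N0 : N%:R != 0 :> R by rewrite pnatr_eq0; case: N kN.
have e : N%:R * node k = k%:R * pi by rewrite /node; field.
case: ifPn => oN; last by rewrite subn0 e cos_natpi mulr1.
rewrite natrB ?(leq_ltn_trans _ kN) // mulrBl e mul1r.
by rewrite cosB cos_natpi sin_natpi mul0r addr0.
Qed.

Lemma sin_mulsub_node k : (0 < k < N)%N ->
  sin ((N - odd N)%:R * node k) = - ((-1) ^+ k * (if odd N then sin (node k) else 0)).
Proof.
move=> /andP[k0 kN]; have N0 : N%:R != 0 :> R by rewrite pnatr_eq0; case: N kN.
have e : N%:R * node k = k%:R * pi by rewrite /node; field.
case: ifPn => oN; last by rewrite subn0 e sin_natpi mulr0 oppr0.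
rewrite natrB ?(leq_ltn_trans _ kN) // mulrBl e mul1r.
by rewrite sinB cos_natpi sin_natpi mul0r add0r.
Qed.

(** Over all N odd nodes modulo 2 pi the sum vanishes. Reflection doubles the nodes in ]0, pi[; for
    odd N the node pi is its own reflection and contributes the term (-1)^k moved to the right. *)
Lemma sum_cos_node k : (0 < k < N)%N ->
  2 * \sum_(1 <= j < N | odd j) cos (k%:R * node j) = - ((-1) ^+ k * (odd N)%:R).
Proof.
move=> kN; have s0 := sin_node_gt0 kN.
apply: (mulfI (lt0r_neq0 s0)); under eq_bigr do rewrite -mul_nodeC.
rewrite mulrCA mulrA sum_odd_cos sin_mulsub_node //.
by case: (odd N); rewrite ?mulr1 ?mulr0; ring.
Qed.

(** With b = [node k / 2], the telescoped value over sin(2b) is cot b for N and k odd, tan b for N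
    odd and k even, cot b + tan b = 2 / sin(2b) for N even and k odd, and 0 otherwise; tan b is the
    cotangent at the index N - k. *)
Lemma sum_sin_node k : (0 < k < N)%N ->
  2 * \sum_(1 <= j < N | odd j) sin (k%:R * node j) =
  (if odd k then cot (node k / 2) else 0) +
  (if odd (N - k) then cot (node (N - k) / 2) else 0).
Proof.
move=> kN; have s0 := sin_node_gt0 kN.
apply: (mulfI (lt0r_neq0 s0)); under eq_bigr do rewrite -mul_nodeC.
rewrite mulrCA mulrA sum_odd_sin cos_mulsub_node // cot_half_nodeB // /cot.
rewrite oddB; last by case/andP: kN => _ /ltnW.
have sh := lt0r_neq0 (sin_half_node_gt0 kN).
have ch := lt0r_neq0 (cos_half_node_gt0 kN).
have e1 := cos2Dsin2 (node k / 2).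
have e2 : node k = (node k / 2) *+ 2 by rewrite mulr2n; field.
move: (node k / 2) sh ch e1 e2 => b sh ch e1 ->.
rewrite sin_mulr2n cos_mulr2n.
have es : cos b ^+ 2 = 1 - sin b ^+ 2 by rewrite -e1 addrK.
rewrite -signr_odd; case: (odd k); case: (odd N) => /=;
 rewrite ?expr1 ?expr0 ?mulr1 ?mul1r ?addr0 ?add0r ?mulr0 ?subrr //.
- have -> : (cos b * sin b) *+ 2 * (cos b / sin b) = 2 * cos b ^+2 by field.
  ring.
- have -> : (cos b * sin b) *+ 2 * (cos b / sin b + sin b / cos b) =
   2 * (cos b ^+ 2 + sin b ^+ 2) by field; rewrite sh ch.
  by rewrite e1; ring.
- have -> : (cos b * sin b) *+ 2 * (sin b / cos b) = 2 * sin b ^+2 by field.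
  by rewrite es; ring.
Qed.

Lemma sum_odd_nodes : (0 < N)%N ->
  2 * \sum_(1 <= j < N | odd j) 1 = N%:R - (odd N)%:R :> R.
Proof.
move=> N0; have: (2 * \sum_(1 <= j < N | odd j) 1 = N - odd N)%N.
  elim: N N0 => [//|[_ _|n IH _]]; first by rewrite big_geq.
  rewrite big_mkcond big_nat_recr //= -big_mkcond mulnDr IH //=.
  by case: (odd n) => /=; rewrite ?subn0 ?subSS ?subn0 ?muln1 ?muln0 ?addn0 ?addn2.
move/(congr1 (fun n => n%:R : R)).
rewrite natrM natr_sum natrB; last by case: (odd N).
by [].
Qed.

(** * Exactness of the quadrature with cotangent weights *)

Lemma cot_half_mul_sinS k x : sin (x / 2) != 0 ->
  cot (x / 2) * sin (k.+1%:R * x) =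
  cot (x / 2) * sin (k%:R * x) + (cos (k.+1%:R * x) + cos (k%:R * x)).
Proof.
move=> s0; pose y := k%:R * x + x / 2.
have -> : k.+1%:R * x = y + x / 2 by rewrite /y -natr1; field.
have -> : k%:R * x = y - x / 2 by rewrite /y addrK.
by clearbody y; rewrite /cot sinB sinD cosB cosD; field.
Qed.

(** From frequency 0 to 1 the increment is odd N + (N - odd N) = N; at each later step the two
    cosine sums have opposite signs and cancel. *)
Lemma sum_cot_sin_node k : (0 < k < N)%N ->
  2 * \sum_(1 <= j < N | odd j) cot (node j / 2) * sin (k%:R * node j) = N%:R.
Proof.
have step n : 2 * \sum_(1 <= j < N | odd j) cot (node j / 2) * sin (n.+1%:R * node j) =
    2 * \sum_(1 <= j < N | odd j) cot (node j / 2) * sin (n%:R * node j)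
    + 2 * \sum_(1 <= j < N | odd j) cos (n.+1%:R * node j)
    + 2 * \sum_(1 <= j < N | odd j) cos (n%:R * node j).
  rewrite -addrA -!mulrDr -!big_split /= big_nat_cond [in RHS]big_nat_cond.
  congr (2 * _); apply: eq_bigr => j /andP[jN _].
  by rewrite cot_half_mul_sinS // lt0r_neq0 ?sin_half_node_gt0.
case: k => [//|k]; rewrite ltnS leq0n /= => kN.
elim: k kN => [|k IH] kN; rewrite step.
  rewrite big1 => [|j _]; last by rewrite mul0r sin0 mulr0.
  under [X in _ + _ + 2 * X]eq_bigr do rewrite mul0r cos0.
  by rewrite sum_cos_node // sum_odd_nodes ?(ltnW kN) //; ring.
rewrite IH ?(ltnW kN) // !sum_cos_node ?(ltnW kN) // exprS; ring.
Qed.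

(** The coefficient of sin(kx) in N^-2 sum_j [F(x - x_j) - F(x + x_j)], where F = [fejer N]; the
    factor N^-2 makes the value 1 at each x_j. *)
Definition fejer_coef k : R :=
  4 / N%:R ^+ 2 * (N%:R - k%:R) * \sum_(1 <= j < N | odd j) sin (k%:R * node j).

(** The two cotangents of [sum_sin_node] give two sums, and reversing k to N - k in the second
    merges them. Keeping f general serves both f k = sin(kx) and f = 1, the latter for the sum of
    coefficients. *)
Lemma sum_fejer_coef (f : nat -> R) :
  \sum_(1 <= k < N) fejer_coef k * f k =
  \sum_(1 <= k < N | odd k) 2 / N%:R ^+ 2 * cot (node k / 2) *
    ((N%:R - k%:R) * f k + k%:R * f (N - k)%N).
Proof.
pose g k := 2 / N%:R ^+ 2 * cot (node k / 2).
have -> : \sum_(1 <= k < N) fejer_coef k * f k =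
    \sum_(1 <= k < N) (if odd k then g k * ((N%:R - k%:R) * f k) else 0) +
    \sum_(1 <= k < N)
      (if odd (N - k) then g (N - k)%N * ((N - k)%:R * f (N - (N - k))%N) else 0).
  rewrite -big_split; apply: eq_big_nat => k kN /=.
  have le_kN : (k <= N)%N by case/andP: kN => _ /ltnW.
  rewrite subKn // natrB //.
  rewrite /fejer_coef -[4]/(2 * 2)%:R natrM.
  have -> S : 2 * 2 / N%:R ^+ 2 * (N%:R - k%:R) * S * f k =
    2 / N%:R ^+ 2 * (N%:R - k%:R) * f k * (2 * S) :> R by ring.
  rewrite sum_sin_node // /g.
  by case: (odd k); case: (odd (N - k)); rewrite ?addr0 ?add0r; ring.
rewrite (sum_nat_rev N (fun k => if odd k then g k * (k%:R * f (N - k)%N) else 0)).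
by rewrite -!big_mkcond -big_split /=; apply: eq_bigr => k _; rewrite mulrDr.
Qed.

(** The translates of F to x_j, to -x_j and, for odd N, to pi add up to N^2. Subtracting the
    interpolant cancels F(x - x_j) and doubles F(x + x_j). *)
Lemma one_sub_fejer_sum x : (0 < N)%N ->
  N%:R ^+ 2 * (1 - \sum_(1 <= k < N) fejer_coef k * sin (k%:R * x)) =
  2 * \sum_(1 <= j < N | odd j) fejer N (x + node j) + (odd N)%:R * fejer N (x - pi).
Proof.
move=> N0; have NR0 : N%:R != 0 :> R by rewrite pnatr_eq0 -lt0n.
have -> : \sum_(1 <= j < N | odd j) fejer N (x + node j) =
    N%:R * \sum_(1 <= j < N | odd j) 1 + 2 * \sum_(1 <= k < N)
      (N%:R - k%:R) * \sum_(1 <= j < N | odd j) cos (k%:R * (x + node j)).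
  under eq_bigr => j _ do rewrite fejerE -[X in X + _]mulr1.
  rewrite big_split /= -!big_distrr /= exchange_big_nat /=; congr (_ + 2 * _).
  by apply: eq_bigr => k _; rewrite big_distrr.
rewrite fejerE.
(* The identity is checked one frequency at a time: the sine parts cancel, and the cosine parts
   vanish by [sum_cos_node]. *)
have key k : (0 < k < N)%N ->
    N%:R ^+ 2 * (fejer_coef k * sin (k%:R * x)) +
    2 * (2 * ((N%:R - k%:R) * \sum_(1 <= j < N | odd j) cos (k%:R * (x + node j)))) +
    (odd N)%:R * (2 * ((N%:R - k%:R) * cos (k%:R * (x - pi)))) = 0.
  move=> kN.
  have -> : \sum_(1 <= j < N | odd j) cos (k%:R * (x + node j)) =
     cos (k%:R * x) * \sum_(1 <= j < N | odd j) cos (k%:R * node j) -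
     sin (k%:R * x) * \sum_(1 <= j < N | odd j) sin (k%:R * node j).
    rewrite !big_distrr -sumrB /=.
    by apply: eq_bigr => j _; rewrite mulrDr cosD.
  have -> : cos (k%:R * (x - pi)) = (-1) ^+ k * cos (k%:R * x).
    by rewrite mulrBr cosB cos_natpi sin_natpi mulr0 addr0 mulrC.
  rewrite /fejer_coef.
  have := sum_cos_node kN.
  move: (\sum_(1 <= j < N | odd j) cos _) (\sum_(1 <= j < N | odd j) sin _) => C S eC.
  have -> : N%:R ^+ 2 * (4 / N%:R ^+ 2 * (N%:R - k%:R) * S * sin (k%:R * x)) =
     4 * (N%:R - k%:R) * S * sin (k%:R * x) by field.
  have -> : 2 * (2 * ((N%:R - k%:R) * (cos (k%:R * x) * C - sin (k%:R * x) * S))) =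
     2 * (N%:R - k%:R) * cos (k%:R * x) * (2 * C) -
     4 * (N%:R - k%:R) * S * sin (k%:R * x) by ring.
  by rewrite eC; ring.
have : \sum_(1 <= k < N) (N%:R ^+ 2 * (fejer_coef k * sin (k%:R * x)) +
    2 * (2 * ((N%:R - k%:R) * \sum_(1 <= j < N | odd j) cos (k%:R * (x + node j)))) +
    (odd N)%:R * (2 * ((N%:R - k%:R) * cos (k%:R * (x - pi))))) = 0.
  by rewrite big_nat big1.
rewrite 2!big_split /= -!big_distrr /=.
(* What remains is the constant term: N^2 = N (N - odd N) + N odd N. *)
have := sum_odd_nodes N0.
move: (\sum_(1 <= k < N) _) (\sum_(1 <= k < N) _) (\sum_(1 <= k < N) _) (\sum_(1 <= j < N | _) 1).
move=> C B A T eT e0.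
have -> : N%:R ^+ 2 * (1 - A) =
  N%:R ^+ 2 + 2 * (2 * B) + (odd N)%:R * (2 * C) -
  (N%:R ^+ 2 * A + 2 * (2 * B) + (odd N)%:R * (2 * C)) by ring.
rewrite e0; have -> : 2 * (N%:R * T + 2 * B) = N%:R * (2 * T) + 2 * (2 * B) by ring.
by rewrite eT; ring.
Qed.

Lemma fejer_sum_le1 x : (0 < N)%N ->
  \sum_(1 <= k < N) fejer_coef k * sin (k%:R * x) <= 1.
Proof.
move=> N0; have N2 : 0 < N%:R ^+ 2 :> R by rewrite exprn_gt0 ?ltr0n.
rewrite -subr_ge0 -(pmulr_rge0 _ N2) one_sub_fejer_sum //.
by rewrite addr_ge0 ?mulr_ge0 ?sumr_ge0 // => *; rewrite fejer_ge0.
Qed.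

Lemma sine_sum_quadrature (a : nat -> R) : (0 < N)%N ->
  \sum_(1 <= k < N) a k =
  \sum_(1 <= j < N | odd j) 2 / N%:R * cot (node j / 2) *
    \sum_(1 <= k < N) a k * sin (k%:R * node j).
Proof.
move=> N0; have NR0 : N%:R != 0 :> R by rewrite pnatr_eq0 -lt0n.
under [RHS]eq_bigr do rewrite big_distrr /=.
rewrite exchange_big_nat /=; apply: eq_big_nat => k kN.
rewrite -[LHS](divfK NR0) -{2}(sum_cot_sin_node kN) mulrA big_distrr /=.
by apply: eq_bigr => j _; ring.
Qed.

End Nodes.

(** * The inequality, its coefficient sum and its optimality, with N = m + 1 *)

Theorem mainTheorem4 (R : realType) (m : nat) (m_gt0 : (0 < m)%N) :
  [/\ forall x : R, extremal_sum m x <= 1,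
      exists a : nat -> R, forall x : R, sine_poly m a x = extremal_sum m x,
      forall a : nat -> R,
        (forall x : R, sine_poly m a x = extremal_sum m x) ->
        \sum_(1 <= k < m.+1) a k = cot_const R m
    & forall a : nat -> R,
        (forall x : R, sine_poly m a x <= 1) ->
        \sum_(1 <= k < m.+1) a k <= cot_const R m].
Proof.
have halfE k : pi * k%:R / (2 * m%:R + 2) = node R m.+1 k / 2.
  rewrite /node -natr1; field.
  have := ler0n R m; lra.
have extE x : extremal_sum m x = sine_poly m (fejer_coef R m.+1) x.
  rewrite /sine_poly (sum_fejer_coef m.+1 (fun k => sin (k%:R * x))).
  rewrite /extremal_sum big_nat_cond [RHS]big_nat_cond.
  apply: eq_bigr => k /andP[/andP[_ lkm] _].
  by rewrite halfE natr1 natrB // ltnW.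
have cotE : cot_const R m =
    \sum_(1 <= j < m.+1 | odd j) 2 / m.+1%:R * cot (node R m.+1 j / 2).
  rewrite /cot_const natr1 big_distrr.
  by apply: eq_bigr => j _; rewrite halfE.
have coefE : \sum_(1 <= k < m.+1) fejer_coef R m.+1 k = cot_const R m.
  (* For f = 1 the bracket (N - k) + k collapses to N, which leaves the quadrature weights. *)
  under eq_bigr do rewrite -[fejer_coef _ _ _]mulr1.
  rewrite (sum_fejer_coef m.+1 (fun=> 1)) cotE.
  by apply: eq_bigr => k _; rewrite !mulr1 subrK; field; rewrite nat1r pnatr_eq0.
split=> [x||a aE|a a_le1].
- by rewrite extE fejer_sum_le1.
- by exists (fejer_coef R m.+1) => x; rewrite extE.
(* By quadrature the coefficient sum depends only on the values at the nodes, so linear independence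
   of the sines is avoided. *)
- rewrite -coefE !(sine_sum_quadrature (N := m.+1)) //.
  apply: eq_bigr => j _; congr (_ * _).
  by have := aE (node R m.+1 j); rewrite extE.
rewrite sine_sum_quadrature // cotE.
(* The range of j must be kept: the weights are known to be nonnegative only for 0 < j < N. *)
rewrite big_nat_cond [leRHS]big_nat_cond ler_sum // => j /andP[jm _].
rewrite ler_piMr //; last exact: a_le1.
by apply: mulr_ge0; [rewrite divr_ge0 ?ler0n | exact: cot_half_node_ge0].
Qed.
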